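(* Let $Q$ be a digraph, let $Q'$ be a symmetric digraph, and let $\phi: Q\to N_{\mathbf{Digra}}(Q')$ be a morphism in $\mathbf{Digra}$. Then there is a unique morphism $\hat{\phi}: N^{\diamond}_{\mathbf{Digra}}(Q)\to Q'$ in $\mathbf{SDigra}$ such that $N_{\mathbf{Digra}}(\hat{\phi})\circ\kappa_{Q}=\phi$.
   Context: A digraph is a pair $Q=(\vec V(Q),\vec E(Q))$ with $\vec V(Q)$ a set and $\vec E(Q)\subseteq\vec V(Q)\times\vec V(Q)$. The category $\mathbf{Digra}$ has digraphs as objects; a morphism $f:Q\to Q'$ is a function $f:\vec V(Q)\to\vec V(Q')$ such that $(v,w)\in\vec E(Q)$ implies $(f(v),f(w))\in\vec E(Q')$. A digraph is symmetric if $(v,w)\in\vec E(Q)$ implies $(w,v)\in\vec E(Q)$. $\mathbf{SDigra}$ is the full subcategory of $\mathbf{Digra}$ consisting of all symmetric digraphs, and $N_{\mathbf{Digra}}:\mathbf{SDigra}\to\mathbf{Digra}$ is the inclusion functor. Symmetric closure: for a digraph $Q$, $N^{\diamond}_{\mathbf{Digra}}(Q)$ is the symmetric digraph with vertex set $\vec V(Q)$ and edge set $\{(v,w):(v,w)\in\vec E(Q)\text{ or }(w,v)\in\vec E(Q)\}$. The morphism $\kappa_Q:Q\to N_{\mathbf{Digra}}N^{\diamond}_{\mathbf{Digra}}(Q)$ in $\mathbf{Digra}$ is the canonical inclusion, i.e. the identity function on vertices. *)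

(* Defs.v *)
From Stdlib Require Import Relations ProofIrrelevance.

Set Implicit Arguments.
Unset Strict Implicit.
Unset Printing Implicit Defensive.

Record category := Category {
  Ob :> Type;
  Hom : Ob -> Ob -> Type;
  idm : forall A, Hom A A;
  comp : forall A B C, Hom B C -> Hom A B -> Hom A C;
  comp_idl : forall A B (f : Hom A B), comp (idm B) f = f;
  comp_idr : forall A B (f : Hom A B), comp f (idm A) = f;
  comp_assoc : forall A B C D (h : Hom C D) (g : Hom B C) (f : Hom A B),
    comp h (comp g f) = comp (comp h g) f
}.
Arguments Hom {c} A B.
Arguments idm {c} A.
Arguments comp {c A B C} g f.

Declare Scope cat_scope.
Notation "g 'o' f" := (comp g f) (at level 40, left associativity) : cat_scope.
Open Scope cat_scope.

Record functor (C D : category) := Functor {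
  fobj :> C -> D;
  fmap : forall A B : C, Hom A B -> Hom (fobj A) (fobj B);
  fmap_id : forall A : C, fmap (idm A) = idm (fobj A);
  fmap_comp : forall (A B E : C) (g : Hom B E) (f : Hom A B),
    fmap (g o f) = fmap g o fmap f
}.
Arguments fmap {C D} F {A B} f : rename.

Definition full_subcategory (C : category) (P : C -> Prop) : category :=
  @Category {A : C | P A}
    (fun A B => Hom (proj1_sig A) (proj1_sig B))
    (fun A => idm (proj1_sig A))
    (fun A B E g f => g o f)
    (fun A B f => comp_idl f)
    (fun A B f => comp_idr f)
    (fun A B E D h g f => comp_assoc h g f).

Definition inclusion (C : category) (P : C -> Prop) :
    functor (full_subcategory P) C :=
  @Functor (full_subcategory P) C
    (fun A => proj1_sig A)
    (fun A B f => f)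
    (fun A => eq_refl)
    (fun A B E g f => eq_refl).

Record digraph := Digraph {
  vertex : Type;
  edge : relation vertex
}.
Arguments edge : clear implicits.

Record digraph_hom (Q Q' : digraph) := DigraphHom {
  vmap :> vertex Q -> vertex Q';
  vmap_edge : forall v w, edge Q v w -> edge Q' (vmap v) (vmap w)
}.

Lemma digraph_hom_eq (Q Q' : digraph) (f g : digraph_hom Q Q') :
  vmap f = vmap g -> f = g.
Proof.
destruct f as [f Hf], g as [g Hg]; simpl; intros <-.
f_equal; apply proof_irrelevance.
Qed.

Definition digraph_id (Q : digraph) : digraph_hom Q Q :=
  @DigraphHom Q Q (fun v => v) (fun v w e => e).

Definition digraph_comp (Q1 Q2 Q3 : digraph)
    (g : digraph_hom Q2 Q3) (f : digraph_hom Q1 Q2) : digraph_hom Q1 Q3 :=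
  @DigraphHom Q1 Q3 (fun v => g (f v))
    (fun v w e => vmap_edge g (vmap_edge f e)).

Definition Digra : category :=
  @Category digraph digraph_hom digraph_id digraph_comp
    (fun A B f =>
       @digraph_hom_eq A B (digraph_comp (digraph_id B) f) f eq_refl)
    (fun A B f =>
       @digraph_hom_eq A B (digraph_comp f (digraph_id A)) f eq_refl)
    (fun A B C D h g f =>
       @digraph_hom_eq A D (digraph_comp h (digraph_comp g f))
         (digraph_comp (digraph_comp h g) f) eq_refl).

Definition symmetric_digraph (Q : Digra) : Prop :=
  symmetric (vertex Q) (edge Q).

Definition SDigra : category := full_subcategory symmetric_digraph.

Definition N_Digra : functor SDigra Digra := inclusion symmetric_digraph.

Definition closure_digraph (Q : Digra) : Digra :=
  @Digraph (vertex Q) (fun v w => edge Q v w \/ edge Q w v).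

Lemma closure_digraph_symmetric (Q : Digra) :
  symmetric_digraph (closure_digraph Q).
Proof. intros v w [e | e]; [right | left]; exact e. Qed.

Definition symmetric_closure (Q : Digra) : SDigra :=
  exist symmetric_digraph (closure_digraph Q) (@closure_digraph_symmetric Q).

Definition kappa (Q : Digra) : Hom Q (N_Digra (symmetric_closure Q)) :=
  @DigraphHom Q (closure_digraph Q) (fun v => v)
    (fun v w e => or_introl e).

(* Main.v *)
Require Import Defs.

(** Since [kappa Q] is the identity on vertices, the vertex map of [phi] is the only candidate. It
    respects the reversed edges added by the closure because [Q'] is symmetric. *)

Theorem theorem2p6 (Q : Digra) (Q' : SDigra) (phi : Hom Q (N_Digra Q')) :
  exists! phihat : Hom (symmetric_closure Q) Q',
    fmap N_Digra phihat o kappa Q = phi.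
Proof.
destruct Q' as [Q' symQ'].
change (digraph_hom Q Q') in phi.
assert (Hedge : forall v w, edge (closure_digraph Q) v w ->
                            edge Q' (phi v) (phi w)).
{ intros v w [e | e]; [| apply symQ']; exact (vmap_edge phi e). }
exists (@DigraphHom (closure_digraph Q) Q' (vmap phi) Hedge); split.
- apply digraph_hom_eq; reflexivity.
(* Substituting the composite for [phi] makes both vertex maps convertible to that of [psi]; the
   edge proofs are irrelevant. *)
- intros psi <-; apply digraph_hom_eq; reflexivity.
Qed.
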